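(* Let $f_1,\dots,f_n:\mathbb{R}^d\to\mathbb{R}$ be differentiable and convex, and suppose that $f=\frac1n\sum_{i=1}^n f_i$ is $\mu$-strongly convex with $\mu>0$. Suppose that $f$ and $f_1,\dots,f_n$ are all $L$-smooth, let $x_\ast$ be the minimizer of $f$, and let $\kappa=L/\mu$ and $\sigma_\ast^2=\frac1n\sum_{i=1}^n\|\nabla f_i(x_\ast)\|^2$. Then, provided the stepsize satisfies $0<\gamma\le\frac{1}{\sqrt2\,Ln}$, the final iterate $x_T$ generated by Random Reshuffling or by Shuffle-Once run for $T$ epochs from $x_0\in\mathbb{R}^d$ satisfies $$\mathbb{E}\left[\|x_T-x_\ast\|^2\right]\le\left(1-\frac{\gamma\mu n}{2}\right)^T\|x_0-x_\ast\|^2+\gamma^2\kappa n\sigma_\ast^2.$$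
   Context: $L$-smooth means that the gradient is $L$-Lipschitz. Algorithms. Both algorithms take a stepsize $\gamma>0$, a starting point $x_0\in\mathbb{R}^d$ and a number of epochs $T$. Random Reshuffling (RR): in each epoch $t=0,1,\dots,T-1$, sample afresh (independently) a uniformly random permutation $\pi=(\pi_0,\pi_1,\dots,\pi_{n-1})$ of $\{1,\dots,n\}$, set $x_t^0=x_t$, perform $x_t^{i+1}=x_t^i-\gamma\nabla f_{\pi_i}(x_t^i)$ for $i=0,1,\dots,n-1$, and set $x_{t+1}=x_t^n$. Shuffle-Once (SO): identical, except that a single uniformly random permutation $\pi$ is sampled once before the first epoch and is used in all epochs. The expectation is over the random permutations. *)

(* Defs.v *)
From HB Require Import structures.
From mathcomp Require Import all_boot all_order all_algebra all_fingroup.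
From mathcomp Require Import all_classical all_reals all_analysis.
Import Order.TTheory GRing.Theory Num.Theory.
Import numFieldNormedType.Exports.

Set Implicit Arguments.
Unset Strict Implicit.
Unset Printing Implicit Defensive.

Local Open Scope classical_set_scope.
Local Open Scope ring_scope.

(* The library norm `|x| on 'rV[R]_d is the sup norm; all norms of vectors
   below are Euclidean. The notions of differentiability and derivative do not
   depend on this choice. *)
Definition enorm (R : realType) (d : nat) (x : 'rV[R]_d) : R :=
  Num.sqrt (\sum_(i < d) x ord0 i ^+ 2).

Definition grad (R : realType) (d : nat) (f : 'rV[R]_d -> R) (x : 'rV[R]_d) :
    'rV[R]_d :=
  \row_(i < d) 'D_(delta_mx ord0 i) f x.

(* Only meaningful for differentiable functions. *)
Definition smooth (R : realType) (d : nat) (L : R) (f : 'rV[R]_d -> R) : Prop :=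
  forall x y, enorm (grad f x - grad f y) <= L * enorm (x - y).

Definition strongly_convex (R : realType) (d : nat) (mu : R)
    (f : 'rV[R]_d -> R) : Prop :=
  forall (x y : 'rV[R]_d) (t : R), 0 <= t <= 1 ->
    f (t *: x + (1 - t) *: y) <=
      t * f x + (1 - t) * f y - mu / 2 * t * (1 - t) * enorm (x - y) ^+ 2.

Definition minimizer (R : realType) (d : nat) (f : 'rV[R]_d -> R)
    (x : 'rV[R]_d) : Prop :=
  forall y, f x <= f y.

Definition average (R : realType) (d n : nat) (f : 'I_n -> 'rV[R]_d -> R) :
    'rV[R]_d -> R :=
  fun x => n%:R^-1 * \sum_(i < n) f i x.

(* \sigma_\ast^2 when x is the minimizer of the average. *)
Definition sigma2 (R : realType) (d n : nat) (f : 'I_n -> 'rV[R]_d -> R)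
    (x : 'rV[R]_d) : R :=
  n%:R^-1 * \sum_(i < n) enorm (grad (f i) x) ^+ 2.

(* The list enum 'I_n is 0, 1, ..., n-1 in this order. *)
Definition epoch (R : realType) (d n : nat) (gamma : R)
    (f : 'I_n -> 'rV[R]_d -> R) (p : 'S_n) (x : 'rV[R]_d) : 'rV[R]_d :=
  foldl (fun y i => y - gamma *: grad (f (p i)) y) x (enum 'I_n).

Fixpoint iterate (R : realType) (d n : nat) (gamma : R)
    (f : 'I_n -> 'rV[R]_d -> R) (x0 : 'rV[R]_d) (p : nat -> 'S_n) (t : nat) :
    'rV[R]_d :=
  if t is t'.+1 then epoch gamma f (p t') (iterate gamma f x0 p t') else x0.

(* S carries its discrete sigma-algebra. *)
Definition random_element (disp : measure_display) (Omega : measurableType disp)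
    (S : finType) (X : Omega -> S) : Prop :=
  forall A : set S, measurable (X @^-1` A).

Definition uniformly_distributed (R : realType) (disp : measure_display)
    (Omega : measurableType disp) (P : probability Omega R) (S : finType)
    (X : Omega -> S) : Prop :=
  forall s : S, P (X @^-1` [set s]) = (#|S|%:R^-1)%:E.

Definition mutually_independent (R : realType) (disp : measure_display)
    (Omega : measurableType disp) (P : probability Omega R) (I S : finType)
    (X : I -> Omega -> S) : Prop :=
  forall (J : {set I}) (A : I -> set S),
    P (\bigcap_(i in [set` J]) (X i @^-1` A i)) =
      (\prod_(i in J) P (X i @^-1` A i))%E.

(* In the next two definitions perms t is the permutation used in epoch t; only
   the epochs t < T matter. *)
Definition random_reshuffling (R : realType) (disp : measure_display)
    (Omega : measurableType disp) (P : probability Omega R) (n T : nat)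
    (perms : nat -> Omega -> 'S_n) : Prop :=
  [/\ forall t, (t < T)%N -> random_element (perms t),
      forall t, (t < T)%N -> uniformly_distributed P (perms t) &
      mutually_independent P (fun t : 'I_T => perms t)].

Definition shuffle_once (R : realType) (disp : measure_display)
    (Omega : measurableType disp) (P : probability Omega R) (n T : nat)
    (perms : nat -> Omega -> 'S_n) : Prop :=
  exists pi0 : Omega -> 'S_n,
    [/\ random_element pi0, uniformly_distributed P pi0 &
        forall t, (t < T)%N -> perms t = pi0].

(* Main.v *)
(* Write r_t = |x_t - xs|^2, a = gamma mu n, v_i = grad f_i xs, and let
   N(pi) be the sum over k of |v_(pi k) + ... + v_(pi (n-1))|^2. Measuring the
   drift inside an epoch backwards, by |x_t^k - x_(t+1)|^2, gives for every
   realization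
     (1 + a) r_(t+1) <= r_t + 2 gamma^3 L N(pi_t):
   the part of the drift caused by the differences of grad f_i between x_t^i and
   xs is absorbed, by cocoercivity and the stepsize condition, by the Bregman
   divergences of the f_i gained in the one-step estimate. The noise N(pi_t)
   does not involve x_t, so its expectation requires only that each pi_t is
   uniform: no independence between epochs is needed, and Random Reshuffling
   and Shuffle-Once are treated at once. Sampling without replacement gives
   that E N is at most n / 2 times the sum of the |v_i|^2. *)

Require Import Defs.
From HB Require Import structures.
From mathcomp Require Import all_boot all_order all_algebra all_fingroup.
From mathcomp Require Import all_classical all_reals all_analysis.
From mathcomp Require Import measurable_realfun.
From mathcomp Require Import ring lra.
Import Order.TTheory GRing.Theory Num.Theory.
Import numFieldNormedType.Exports.
Set Implicit Arguments.
Unset Strict Implicit.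
Unset Printing Implicit Defensive.
Local Open Scope classical_set_scope.
Local Open Scope ring_scope.

(** * Euclidean inner product *)

(** Squared Euclidean norms are handled as [dot u u], which expands bilinearly and keeps square
    roots out of the estimates. *)
Definition dot (R : realType) (d : nat) (u v : 'rV[R]_d) : R :=
  \sum_(i < d) u ord0 i * v ord0 i.

Lemma enorm_sqr (R : realType) (d : nat) (u : 'rV[R]_d) :
  enorm u ^+ 2 = dot u u.
Proof.
rewrite /enorm sqr_sqrtr; last by apply: sumr_ge0 => i _; exact: sqr_ge0.
by apply: eq_bigr => i _; rewrite expr2.
Qed.

Lemma dot_ge0 (R : realType) (d : nat) (u : 'rV[R]_d) : 0 <= dot u u.
Proof. by rewrite -enorm_sqr sqr_ge0. Qed.

Lemma dot_eq0 (R : realType) (d : nat) (u : 'rV[R]_d) :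
  (dot u u == 0) = (u == 0).
Proof.
apply/eqP/eqP => [/eqP|->]; last first.
  by rewrite /dot big1// => i _; rewrite mxE mul0r.
rewrite psumr_eq0 => [/allP u0|i _]; last by rewrite -expr2 sqr_ge0.
apply/rowP => i; rewrite mxE; apply/eqP.
by have := u0 i (mem_index_enum i); rewrite /= -expr2 sqrf_eq0.
Qed.

Lemma dotC (R : realType) (d : nat) (u v : 'rV[R]_d) : dot u v = dot v u.
Proof. by apply: eq_bigr => i _; rewrite mulrC. Qed.

Lemma dotDl (R : realType) (d : nat) (u v w : 'rV[R]_d) :
  dot (u + v) w = dot u w + dot v w.
Proof.
by rewrite -big_split; apply: eq_bigr => i _; rewrite mxE mulrDl.
Qed.

Lemma dotZl (R : realType) (d : nat) (a : R) (u v : 'rV[R]_d) :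
  dot (a *: u) v = a * dot u v.
Proof. by rewrite mulr_sumr; apply: eq_bigr => i _; rewrite mxE mulrA. Qed.

Lemma dotNl (R : realType) (d : nat) (u v : 'rV[R]_d) :
  dot (- u) v = - dot u v.
Proof. by rewrite -scaleN1r dotZl mulN1r. Qed.

Lemma dotDr (R : realType) (d : nat) (u v w : 'rV[R]_d) :
  dot w (u + v) = dot w u + dot w v.
Proof. by rewrite !(dotC w) dotDl. Qed.

Lemma dotZr (R : realType) (d : nat) (a : R) (u v : 'rV[R]_d) :
  dot v (a *: u) = a * dot v u.
Proof. by rewrite !(dotC v) dotZl. Qed.

Lemma dotNr (R : realType) (d : nat) (u v : 'rV[R]_d) :
  dot v (- u) = - dot v u.
Proof. by rewrite !(dotC v) dotNl. Qed.

Definition dotE := (dotDl, dotDr, dotZl, dotZr, dotNl, dotNr).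

Lemma dot0l (R : realType) (d : nat) (v : 'rV[R]_d) : dot 0 v = 0.
Proof. by rewrite -(scale0r 0) dotZl mul0r. Qed.

Lemma dot_suml (R : realType) (d : nat) (I : finType) (A : pred I)
    (u : I -> 'rV[R]_d) (v : 'rV[R]_d) :
  dot (\sum_(i | A i) u i) v = \sum_(i | A i) dot (u i) v.
Proof.
by apply: (big_morph (fun u => dot u v)) => [u1 u2|]; rewrite (dotDl, dot0l).
Qed.

Lemma dot_sumr (R : realType) (d : nat) (I : finType) (A : pred I)
    (u : I -> 'rV[R]_d) (v : 'rV[R]_d) :
  dot v (\sum_(i | A i) u i) = \sum_(i | A i) dot v (u i).
Proof. by rewrite dotC dot_suml; apply: eq_bigr => i _; rewrite dotC. Qed.

Lemma dot_sqrD_le (R : realType) (d : nat) (u v : 'rV[R]_d) :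
  dot (u + v) (u + v) <= 2 * dot u u + 2 * dot v v.
Proof.
have := dot_ge0 (u - v); rewrite !dotE (dotC v u); lra.
Qed.

Lemma dot_young (R : realType) (d : nat) (a : R) (u v : 'rV[R]_d) : 0 < a ->
  dot u v <= (2 * a)^-1 * dot u u + a / 2 * dot v v.
Proof.
move=> a0; have := dot_ge0 (a^-1 *: u - v).
rewrite !dotE (dotC v u) => h.
have {}h : 0 <= a / 2 * (a^-1 * (a^-1 * dot u u + - dot u v) +
    - (a^-1 * dot u v - dot v v)).
  by rewrite mulr_ge0 ?divr_ge0 ?(ltW a0)//; move: h; lra.
rewrite -subr_ge0; apply: le_trans h _; rewrite le_eqVlt; apply/orP; left.
by apply/eqP; field; rewrite gt_eqF.
Qed.

(** Each cross term is at most the mean of the two squared norms. Enlarging the bound from [A] to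
    all of [I] makes it the same for every tail of an epoch. *)
Lemma dot_sqr_sum_le (R : realType) (d : nat) (I : finType) (A : pred I)
    (u : I -> 'rV[R]_d) :
  dot (\sum_(i | A i) u i) (\sum_(i | A i) u i) <=
  #|I|%:R * \sum_i dot (u i) (u i).
Proof.
set S := \sum_i dot (u i) (u i).
set SA := \sum_(i | A i) dot (u i) (u i).
have S0 : 0 <= SA by apply: sumr_ge0 => i _; exact: dot_ge0.
have SAS : SA <= S.
  by rewrite /S (bigID A)/= lerDl; apply: sumr_ge0 => i _; exact: dot_ge0.
apply: (@le_trans _ _ (#|A|%:R * SA)); last first.
  by apply: ler_pM => //; rewrite ler_nat max_card.
rewrite dot_suml.
apply: (@le_trans _ _ (\sum_(i | A i) \sum_(j | A j)
    (2^-1 * dot (u i) (u i) + 2^-1 * dot (u j) (u j)))).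
  apply: ler_sum => i _; rewrite dot_sumr; apply: ler_sum => j _.
  by have := dot_ge0 (u i - u j); rewrite !dotE (dotC (u j)); lra.
under eq_bigr do rewrite big_split/= sumr_const -mulr_sumr -/SA.
rewrite big_split/= sumr_const sumrMnl -mulr_sumr -/SA.
rewrite -[X in _ + X]mulr_natl -[X in X + _]mulr_natl.
by rewrite le_eqVlt; apply/orP; left; apply/eqP; field.
Qed.

Lemma dotNN (R : realType) (d : nat) (u : 'rV[R]_d) :
  dot (- u) (- u) = dot u u.
Proof. by rewrite dotNl dotNr opprK. Qed.

(** * Smooth convex functions *)

Lemma derive_grad (R : realType) (d : nat) (f : 'rV[R]_d -> R)
    (x h : 'rV[R]_d) :
  differentiable f x -> 'D_h f x = dot (grad f x) h.
Proof.
move=> df; rewrite deriveE// [in LHS](row_sum_delta h) linear_sum.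
apply: eq_bigr => i _; rewrite linearZ mxE deriveE// mulrC.
by rewrite /GRing.scale.
Qed.

Lemma is_derive_line (R : realType) (d : nat) (f : 'rV[R]_d -> R)
    (x h : 'rV[R]_d) (t : R) :
  differentiable f (x + t *: h) ->
  is_derive t 1 (fun s => f (x + s *: h)) (dot (grad f (x + t *: h)) h).
Proof.
move=> df.
have E : (fun s : R => s^-1 *: (((fun s => f (x + s *: h)) \o shift t) (s *: 1)
      - f (x + t *: h))) =
    (fun s : R => s^-1 *: ((f \o shift (x + t *: h)) (s *: h)
      - f (x + t *: h))).
  apply/funext => s; congr (_ *: (f _ - _)).
  by rewrite /= [s *: 1]mulr1 scalerDl addrCA.
apply: DeriveDef.
  by rewrite /derivable E; exact: diff_derivable.
by rewrite /derive E -derive_grad.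
Qed.

Lemma convex_grad_le (R : realType) (d : nat) (f : 'rV[R]_d -> R)
    (x y : 'rV[R]_d) :
  differentiable f x -> convex_function setT f ->
  f x + dot (grad f x) (y - x) <= f y.
Proof.
move=> df cf; rewrite -derive_grad// addrC -lerBrDr.
have cv : derivable f x (y - x) by exact: diff_derivable.
rewrite /derivable in cv.
(* Convexity bounds the difference quotient by f y - f x only for 0 < s <= 1, hence the passage to
   the right-hand limit. *)
have cvr := cvg_dnbhs_at_right cv.
rewrite /derive cvg_at_rightE//.
apply: limr_le; first by apply/cvg_ex; eexists; exact: cvr.
near=> s.
have s0 : 0 < s by near: s; exact: nbhs_right_gt.
have s1 : s <= 1 by near: s; exact: nbhs_right_le.
have h : f (s *: y + (1 - s) *: x) <= s * f y + (1 - s) * f x.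
  by apply: (cf (Itv01 (ltW s0) s1) y x); rewrite in_setT.
rewrite [_ *: _]mulrC ler_pdivrMr//=.
rewrite (_ : s *: (y - x) + x = s *: y + (1 - s) *: x).
  suff : f (s *: y + (1 - s) *: x) - f x <= (f y - f x) * s by [].
  by move: h; lra.
by rewrite scalerBr scalerBl scale1r addrAC -addrA.
Unshelve. all: by end_near. Qed.

Lemma is_derive_quadratic (R : realType) (c k s : R) :
  is_derive s 1 (fun t => c * t + k * t ^+ 2) (c + k * (2 * s)).
Proof.
have h2 := @is_deriveX R _ id 2 s 1 1 (is_derive_id _ _).
have h1 := is_deriveZ c (is_derive_id s (1 : R)).
by have := is_deriveD h1 (is_deriveZ k h2); rewrite /GRing.scale/= !mulr1 expr1.
Qed.

Lemma smooth_sqr (R : realType) (d : nat) (f : 'rV[R]_d -> R) (L : R)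
    (x y : 'rV[R]_d) : smooth L f ->
  dot (grad f x - grad f y) (grad f x - grad f y) <=
  L ^+ 2 * dot (x - y) (x - y).
Proof.
move=> /(_ x y) sf; rewrite -!enorm_sqr -exprMn ler_sqr// nnegrE ?sqrtr_ge0//.
exact: le_trans (sqrtr_ge0 _) sf.
Qed.

(** Along the segment from x to y, subtracting the linear and quadratic terms from f leaves a
    function [phi] with nonpositive derivative on (0, 1), so the mean value theorem gives phi 1 <=
    phi 0. *)
Lemma descent (R : realType) (d : nat) (f : 'rV[R]_d -> R) (L : R)
    (x y : 'rV[R]_d) :
  0 < L -> (forall z, differentiable f z) -> smooth L f ->
  f y <= f x + dot (grad f x) (y - x) + L / 2 * dot (y - x) (y - x).
Proof.
move=> L0 df sf; set h := y - x.
pose k := L / 2 * dot h h.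
pose c := dot (grad f x) h.
pose phi (s : R) := f (x + s *: h) - (c * s + k * s ^+ 2).
pose dphi s := dot (grad f (x + s *: h)) h - (c + k * (2 * s)).
have dphiE (s : R) : is_derive s 1 phi (dphi s).
  apply: is_deriveB (is_derive_quadratic c k s).
  exact: is_derive_line.
have [|s] := MVT ltr01 (fun s (_ : s \in _) => dphiE s).
  apply: continuous_subspaceT => z.
  by apply/differentiable_continuous/derivable1_diffP; have [] := dphiE z.
rewrite in_itv /= => /andP[s0 s1]; rewrite subr0 mulr1 /phi /dphi => E.
have sm := smooth_sqr (x + s *: h) x sf.
(* The weight L s balances Young's inequality: with the Lipschitz bound, both halves equal L s |h|^2
   / 2. *)
have yg := dot_young (grad f (x + s *: h) - grad f x) h (mulr_gt0 L0 s0).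
have {}yg : dot (grad f (x + s *: h)) h - c <= L * s * dot h h.
  rewrite -dotNl -dotDl; apply: le_trans yg _.
  rewrite addrAC subrr add0r dotZl dotZr in sm.
  apply: (@le_trans _ _ ((2 * (L * s))^-1 * (L ^+ 2 * (s * (s * dot h h))) +
      L * s / 2 * dot h h)).
    by rewrite lerD2r ler_wpM2l// invr_ge0 !mulr_ge0// ltW.
  by rewrite le_eqVlt; apply/orP; left; apply/eqP; field; rewrite !gt_eqF.
move: E; rewrite scale1r scale0r addr0 mulr1 mulr0 expr1n expr0n/= !mulr0.
rewrite /h [x + _]addrC subrK -/h.
by move: yg; rewrite /k -/c; lra.
Qed.

(** At any point z, f lies above its tangent at x and below its quadratic upper model at y. The
    choice z = y + u / L makes the comparison of the two sharpest. *)
Lemma cocoercive (R : realType) (d : nat) (f : 'rV[R]_d -> R) (L : R)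
    (x y : 'rV[R]_d) :
  0 < L -> (forall z, differentiable f z) -> convex_function setT f ->
  smooth L f ->
  dot (grad f x - grad f y) (grad f x - grad f y) <=
  2 * L * (f y - f x - dot (grad f x) (y - x)).
Proof.
move=> L0 df cf sf; set u := grad f x - grad f y.
pose z := y + L^-1 *: u.
have h1 := convex_grad_le z (df x) cf.
have h2 := descent y z L0 df sf.
have zy : z - y = L^-1 *: u by rewrite /z addrAC subrr add0r.
have zx : z - x = L^-1 *: u + (y - x) by rewrite -zy subrKA.
rewrite zx dotDr dotZr in h1; rewrite zy !(dotZl, dotZr) in h2.
have uE : dot u u = dot (grad f x) u - dot (grad f y) u.
  by rewrite -dotNl -dotDl.
have e : L / 2 * (L^-1 * (L^-1 * dot u u)) = L^-1 * dot u u / 2.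
  by field; rewrite gt_eqF.
have h3 : L^-1 * dot u u / 2 <= f y - f x - dot (grad f x) (y - x).
  have : L^-1 * dot u u = L^-1 * dot (grad f x) u - L^-1 * dot (grad f y) u.
    by rewrite uE mulrBr.
  by move: h1 h2 e; lra.
have := ler_wpM2l (ltW (mulr_gt0 (ltr0n _ 2) L0)) h3.
have -> : 2 * L * (L^-1 * dot u u / 2) = dot u u by field; rewrite gt_eqF.
by [].
Qed.

Lemma strongly_convex_minimizer (R : realType) (d : nat) (f : 'rV[R]_d -> R)
    (mu : R) (x y : 'rV[R]_d) :
  0 < mu -> strongly_convex mu f -> minimizer f x ->
  mu / 2 * dot (y - x) (y - x) <= f y - f x.
Proof.
move=> mu0 sc mx; rewrite -enorm_sqr; set B := _ * _.
have B0 : 0 <= B by rewrite mulr_ge0 ?sqr_ge0// divr_ge0 ?ltW.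
rewrite leNgt; apply/negP => AB.
have A0 : 0 <= f y - f x by rewrite subr_ge0.
have B1 : 0 < B := le_lt_trans A0 AB.
have key t : 0 < t -> t <= 1 -> (1 - t) * B <= f y - f x.
  move=> t0 t1; have t01 : 0 <= t <= 1 by rewrite ltW.
  have h := le_trans (mx _) (sc y x t t01).
  rewrite -(ler_pM2l t0) /B -subr_ge0; move: h; rewrite -subr_ge0.
  by set e := enorm _ ^+ 2; congr (_ <= _); ring.
(* Instead of letting t tend to 0 in [key], take the t for which (1 - t) B is the midpoint of B and
   f y - f x; it exceeds f y - f x, a contradiction. *)
have /key : 0 < (B - (f y - f x)) / (2 * B).
  by rewrite divr_gt0 ?subr_gt0// mulr_gt0.
have : (B - (f y - f x)) / (2 * B) <= 1.
  by rewrite ler_pdivrMr ?mul1r; lra.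
move=> /[swap]/[apply]; apply/negP; rewrite -ltNge.
have -> : (1 - (B - (f y - f x)) / (2 * B)) * B = (B + (f y - f x)) / 2.
  by field; rewrite gt_eqF.
lra.
Qed.

(** A gradient step of length 1 / (n L) along the sum G of the gradients lowers the sum of the f i
    by at least |G|^2 / (2 n L), which minimality allows only if G = 0. *)
Lemma minimizer_average_grad (R : realType) (d n : nat)
    (f : 'I_n -> 'rV[R]_d -> R) (L : R) (x : 'rV[R]_d) :
  (0 < n)%N -> 0 < L -> (forall i z, differentiable (f i) z) ->
  (forall i, smooth L (f i)) -> minimizer (average f) x ->
  \sum_i grad (f i) x = 0.
Proof.
move=> n0 L0 df sf mx; set G := \sum_i _.
have nR0 : 0 < n%:R :> R by rewrite ltr0n.
pose y := x - (n%:R * L)^-1 *: G.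
have yx : y - x = - ((n%:R * L)^-1 *: G) by rewrite /y addrAC subrr add0r.
have h : \sum_i f i x <= \sum_i f i y.
  by have := mx y; rewrite /average ler_pM2l ?invr_gt0.
have : \sum_i f i y <= \sum_i (f i x + dot (grad (f i) x) (y - x) +
    L / 2 * dot (y - x) (y - x)).
  by apply: ler_sum => i _; exact: descent.
rewrite !big_split/= -dot_suml -/G sumr_const card_ord => h2.
have {h h2} := le_trans h h2; rewrite -addrA lerDl yx !dotE -mulr_natl => h.
have e : 0 <= - ((n%:R * L)^-1 * dot G G) / 2.
  by apply: le_trans h _; rewrite le_eqVlt; apply/orP; left; apply/eqP; field;
    rewrite !gt_eqF.
have {e} : dot G G <= 0.
  rewrite -(pmulr_rle0 _ (_ : 0 < (n%:R * L)^-1)) ?invr_gt0 ?mulr_gt0//.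
  by move: e; lra.
by move=> G0; apply/eqP; rewrite -dot_eq0 eq_le G0 dot_ge0.
Qed.

(** * One epoch *)

(* D i are Bregman divergences, W i the deviations of the gradients from those
   at x; the drift dev is measured from the end point y n of the epoch. *)
Lemma epoch_descent (R : realType) (d n : nat) (g : 'I_n -> 'rV[R]_d -> R)
    (L gamma : R) (y : nat -> 'rV[R]_d) (x : 'rV[R]_d) :
  0 < L -> 0 < gamma -> 2 * (gamma * L * n%:R) ^+ 2 <= 1 ->
  (forall i z, differentiable (g i) z) ->
  (forall i, convex_function setT (g i)) -> (forall i, smooth L (g i)) ->
  (forall i : 'I_n, y i.+1 = y i - gamma *: grad (g i) (y i)) ->
  dot (y n - x) (y n - x) + 2 * gamma * \sum_i (g i (y n) - g i x) <=
  dot (y 0%N - x) (y 0%N - x) + 2 * gamma ^+ 3 * L *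
    \sum_(k < n) dot (\sum_(i < n | (k <= i)%N) grad (g i) x)
                     (\sum_(i < n | (k <= i)%N) grad (g i) x).
Proof.
move=> L0 gm0 small dg cg sg ystep.
pose G i := grad (g i) (y i).
pose D (i : 'I_n) := g i x - g i (y i) - dot (G i) (x - y i).
pose W i := G i - grad (g i) x.
pose S (k : nat) := \sum_(i < n | (k <= i)%N) grad (g i) x.
have WD i : dot (W i) (W i) <= 2 * L * D i by exact: cocoercive.
have D0 i : 0 <= D i.
  have /(le_trans (dot_ge0 _)) := WD i.
  by rewrite pmulr_rge0// mulr_gt0.
have yE k : (k <= n)%N -> y k - y n = gamma *: \sum_(i < n | (k <= i)%N) G i.
  move=> kn; rewrite scaler_sumr -opprB -telescope_sumr// -sumrN.
  rewrite (big_nat_widenl _ 0)// big_mkord.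
  by apply: eq_bigr => i _; rewrite ystep opprB opprD opprK addrA subrr add0r.
(* The tail of the [G i] is the tail of the [W i] plus [S k]. Splitting the square costs a factor 2,
   [dot_sqr_sum_le] a factor n, and cocoercivity 2 L. *)
have dev (k : 'I_n) : dot (y n - y k) (y n - y k) <=
    4 * gamma ^+ 2 * n%:R * L * \sum_i D i + 2 * gamma ^+ 2 * dot (S k) (S k).
  rewrite -dotNN opprB yE ?(ltnW (ltn_ord k))// dotZl dotZr mulrA -expr2.
  have -> : \sum_(i < n | (k <= i)%N) G i = \sum_(i < n | (k <= i)%N) W i + S k.
    by rewrite -big_split; apply: eq_bigr => i _; rewrite /W/= subrK.
  apply: (@le_trans _ _ (gamma ^+ 2 * (2 * (n%:R * (2 * L * \sum_i D i)) +
      2 * dot (S k) (S k)))); last first.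
    by rewrite le_eqVlt; apply/orP; left; apply/eqP; ring.
  rewrite ler_wpM2l ?sqr_ge0//; apply: le_trans (dot_sqrD_le _ _) _.
  rewrite lerD2r ler_wpM2l//; apply: le_trans (dot_sqr_sum_le _ _) _.
  by rewrite card_ord ler_wpM2l// mulr_sumr; apply: ler_sum => i _.
(* Split y n - x at [y i]: smoothness bounds the part towards [y n], and the part towards x is exact
   by the definition of [D i]. *)
have step (i : 'I_n) : g i (y n) - g i x + D i - L / 2 *
    dot (y n - y i) (y n - y i) <= dot (G i) (y n - x).
  have := descent (y i) (y n) L0 (dg i) (sg i).
  have -> : y n - x = (y n - y i) - (x - y i) by rewrite opprB addrA subrK.
  by rewrite [X in _ -> _ <= X]dotDr dotNr /D -/(G i); lra.
set F := \sum_i _; set N := \sum_(k < n) _.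
set V := \sum_(i < n) dot (y n - y i) (y n - y i).
set SD := \sum_i D i in dev.
have SD0 : 0 <= SD by apply: sumr_ge0.
have hstep : F + SD - L / 2 * V <= dot (\sum_i G i) (y n - x).
  rewrite dot_suml /F /SD /V mulr_sumr -big_split/= -sumrB.
  exact: ler_sum.
have hdev : V <= n%:R * (4 * gamma ^+ 2 * n%:R * L * SD) + 2 * gamma ^+ 2 * N.
  have cE (c : R) : n%:R * c = \sum_(k < n) c.
    by rewrite sumr_const card_ord mulr_natl.
  rewrite /N [X in _ + X]mulr_sumr cE -big_split/=.
  by apply: ler_sum => i _; exact: dev.
have -> : y 0%N - x = (y n - x) + gamma *: \sum_i G i.
  by rewrite -(yE 0%N)// [RHS]addrC subrKA.
move: (y n - x) (\sum_i G i) hstep => u w hstep.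
rewrite !dotE (dotC u w).
(* The drift costs gamma L V, whose share in [SD] is 2 gamma SD times 2 (gamma L n)^2; by [small]
   the gain 2 gamma SD covers it. The square gamma^2 |w|^2 is dropped as nonnegative. *)
have h1 := ler_wpM2l (ltW gm0) hstep.
have h2 := ler_wpM2l (ltW (mulr_gt0 gm0 L0)) hdev.
have h3 := ler_wpM2l (mulr_ge0 (ltW gm0) SD0) small.
have h4 : 0 <= gamma * (gamma * dot w w).
  by rewrite !mulr_ge0 ?dot_ge0// ltW.
move: h1 h2 h3 h4.
nra.
Qed.

(** * Sampling without replacement *)

(** Precomposing with a transposition shows that all positions i give the same sum; over all
    positions together, each of the n! permutations contributes every |v j|^2 once. *)
Lemma sum_perm_dot_diag (R : realType) (d n : nat) (v : 'I_n -> 'rV[R]_d)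
    (i : 'I_n) :
  n%:R * \sum_(p : 'S_n) dot (v (p i)) (v (p i)) =
  n`!%:R * \sum_j dot (v j) (v j).
Proof.
have c j : \sum_(p : 'S_n) dot (v (p j)) (v (p j)) =
    \sum_(p : 'S_n) dot (v (p i)) (v (p i)).
  rewrite (reindex_inj (mulgI (tperm i j))); apply: eq_bigr => p _.
  by rewrite permM tpermR.
transitivity (\sum_j \sum_(p : 'S_n) dot (v (p j)) (v (p j))).
  by rewrite (eq_bigr _ (fun j _ => c j)) sumr_const card_ord mulr_natl.
rewrite exchange_big /= -card_Sn -sum1_card natr_sum mulr_suml.
apply: eq_big => [p|p _]; first by rewrite inE.
by rewrite mul1r [RHS](reindex_perm p).
Qed.

(** By symmetry every k != i gives the same sum as j. Added over these k, the terms for one p give -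
    |v (p i)|^2, since the vectors sum to 0. *)
Lemma sum_perm_dot_le0 (R : realType) (d n : nat) (v : 'I_n -> 'rV[R]_d)
    (i j : 'I_n) :
  \sum_k v k = 0 -> i != j -> \sum_(p : 'S_n) dot (v (p i)) (v (p j)) <= 0.
Proof.
move=> v0 ij; have ji : j != i by rewrite eq_sym.
set c := \sum_p _.
have cE k : k != i -> \sum_(p : 'S_n) dot (v (p i)) (v (p k)) = c.
  move=> ki; rewrite (reindex_inj (mulgI (tperm j k))); apply: eq_bigr => p _.
  by rewrite !permM tpermR (tpermD ji ki).
have : \sum_(k | k != i) \sum_(p : 'S_n) dot (v (p i)) (v (p k)) <= 0.
  rewrite exchange_big; apply: sumr_le0 => p _ /=; rewrite -dot_sumr.
  have : \sum_k v (p k) = 0 by rewrite -[RHS]v0 [RHS](reindex_perm p).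
  rewrite (bigD1 i)//= addrC => /eqP; rewrite addr_eq0 => /eqP ->.
  by rewrite dotNr oppr_le0 dot_ge0.
under eq_bigr => k ki do rewrite (cE _ ki).
rewrite sumr_const -mulr_natl pmulr_rle0// ltr0n.
by apply/card_gt0P; exists j.
Qed.

Lemma sum_ord_le_sqr (R : realFieldType) (n : nat) :
  \sum_(k < n) (k%:R : R) <= n%:R ^+ 2 / 2.
Proof.
elim: n => [|n IHn]; first by rewrite big_ord0 divr_ge0// sqr_ge0.
by rewrite big_ord_recr/= -natr1; move: IHn; lra.
Qed.

(* The off-diagonal correlations are nonpositive, and since the vectors sum to
   0 the tail from k can be traded for the k initial terms. *)
Lemma sum_perm_tail_le (R : realType) (d n : nat) (v : 'I_n -> 'rV[R]_d) :
  (0 < n)%N -> \sum_k v k = 0 ->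
  \sum_(p : 'S_n) \sum_(k < n) dot (\sum_(i < n | (k <= i)%N) v (p i))
    (\sum_(i < n | (k <= i)%N) v (p i)) <=
  n`!%:R * (n%:R / 2 * \sum_j dot (v j) (v j)).
Proof.
move=> n0 v0; rewrite exchange_big/=; set Q := \sum_j dot (v j) (v j).
have nR : n%:R != 0 :> R by rewrite pnatr_eq0 -lt0n.
have tail (k : 'I_n) : \sum_(p : 'S_n) dot (\sum_(i < n | (k <= i)%N) v (p i))
    (\sum_(i < n | (k <= i)%N) v (p i)) <= k%:R * (n`!%:R / n%:R * Q).
  (* The k initial terms lead to the sum of k over k < n, which is n (n - 1) / 2; the n - k tail
     terms would give n (n + 1) / 2, above the n^2 / 2 aimed at. *)
  have swap (p : 'S_n) : \sum_(i < n | (k <= i)%N) v (p i) =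
      - \sum_(i < n | (i < k)%N) v (p i).
    apply/eqP; rewrite -addr_eq0; apply/eqP.
    rewrite -[RHS]v0 [RHS](reindex_perm p).
    rewrite [RHS](bigID (fun i : 'I_n => (k <= i)%N))/=.
    by congr (_ + _); apply: eq_bigl => i; rewrite ltnNge.
  under eq_bigr do rewrite swap dotNN dot_suml.
  rewrite exchange_big/=.
  apply: (@le_trans _ _ (\sum_(i < n | (i < k)%N) (n`!%:R / n%:R * Q))).
    apply: ler_sum => i ik; under eq_bigr do rewrite dot_sumr.
    rewrite exchange_big/= (bigD1 i)//=.
    rewrite [X in _ <= X](_ : _ = \sum_(p : 'S_n) dot (v (p i)) (v (p i))).
      rewrite gerDl; apply: sumr_le0 => j /andP[_ ji].
      by apply: sum_perm_dot_le0 => //; rewrite eq_sym.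
    by apply: (mulfI nR);
      rewrite sum_perm_dot_diag -/Q mulrA [n%:R * _]mulrC divfK.
  by rewrite (big_ord_narrow (ltnW (ltn_ord k))) sumr_const card_ord
    -[X in X <= _]mulr_natl.
apply: (le_trans (ler_sum _ (fun k (_ : true) => tail k))).
rewrite -mulr_suml.
have -> : n`!%:R * (n%:R / 2 * Q) = n%:R ^+ 2 / 2 * (n`!%:R / n%:R * Q).
  by set m := n`!%:R; field.
rewrite ler_wpM2r ?sum_ord_le_sqr// mulr_ge0 ?divr_ge0//.
by apply: sumr_ge0 => j _; exact: dot_ge0.
Qed.

(** * Expectations over random permutations *)

Lemma measurable_fun_random_element (R : realType) (disp : measure_display)
    (Omega : measurableType disp) (S : finType) (X : Omega -> S) (h : S -> R) :
  random_element X -> measurable_fun setT (h \o X).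
Proof.
move=> mX _ A _; rewrite setTI comp_preimage; exact: mX.
Qed.

Lemma integral_uniform_finite (R : realType) (disp : measure_display)
    (Omega : measurableType disp) (P : probability Omega R) (S : finType)
    (X : Omega -> S) (h : S -> R) :
  random_element X -> uniformly_distributed P X -> (forall s, 0 <= h s) ->
  (\int[P]_w (h (X w))%:E)%E = (#|S|%:R^-1 * \sum_s h s)%:E.
Proof.
move=> mX uX h0.
have hE w : (h (X w))%:E =
    (\sum_(s : S) (h s)%:E * (\1_(X @^-1` [set s]) w)%:E)%E.
  rewrite (bigD1 (X w))//= big1 ?addr0 ?adde0.
    by rewrite indicE mem_set// mule1.
  move=> s sX; rewrite indicE memNset ?mule0// => /= E.
  by rewrite E eqxx in sX.
under eq_integral do rewrite hE.
rewrite ge0_integral_sum//=; last 2 first.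
- move=> s; apply/measurable_funeM/measurable_EFinP.
  exact: measurable_indic.
- by move=> s w _; rewrite mule_ge0 ?lee_fin ?indicE.
rewrite mulr_sumr -sumEFin; apply: eq_bigr => s _.
rewrite ge0_integralZl_EFin//; last first.
  by apply/measurable_EFinP; exact: measurable_indic.
by rewrite integral_indic// setIT [X in (_ * X)%E](uX s) -EFinM mulrC.
Qed.

(** Linearity reduces the expectation to the marginal laws of the [X t], which are the same for both
    shuffling schemes. *)
Lemma expectation_sum_uniform (R : realType) (disp : measure_display)
    (Omega : measurableType disp) (P : probability Omega R) (S : finType)
    (T : nat) (X : nat -> Omega -> S) (b : R) (h : nat -> S -> R) :
  (forall t, (t < T)%N -> random_element (X t)) ->
  (forall t, (t < T)%N -> uniformly_distributed P (X t)) ->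
  0 <= b -> (forall t s, 0 <= h t s) ->
  'E_P[(fun w => b + \sum_(t < T) h t (X t w))%R]%E =
  (b + \sum_(t < T) #|S|%:R^-1 * \sum_s h t s)%:E.
Proof.
move=> mX uX b0 h0; rewrite unlock.
have mh (t : 'I_T) : measurable_fun setT (fun w => (h t (X t w))%:E).
  apply/measurable_EFinP.
  exact: (measurable_fun_random_element (h t) (mX t (ltn_ord t))).
under eq_integral do rewrite EFinD -sumEFin.
have s0 w : [set: Omega] w -> (0 <= \sum_(t < T) (h t (X t w))%:E)%E.
  by move=> _; apply: sume_ge0 => t _; rewrite lee_fin.
have ms : measurable_fun setT (fun w => \sum_(t < T) (h t (X t w))%:E)%E.
  exact: emeasurable_sum.
rewrite ge0_integralD//.
rewrite integral_cst// [X in (_ * X)%E]probability_setT mule1.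
rewrite ge0_integral_sum//;
  last by move=> t w _; rewrite lee_fin.
rewrite EFinD -sumEFin; congr (_ + _)%E; apply: eq_bigr => t _.
by apply: integral_uniform_finite => //; [exact: mX|exact: uX].
Qed.

(** The iterate depends on finitely many discrete variables, so [A] can be arbitrary. This lets the
    induction split on the last permutation and replace [A] by its preimage under an epoch, whatever
    the gradients are. *)
Lemma measurable_iterate (R : realType) (d n : nat) (gamma : R)
    (f : 'I_n -> 'rV[R]_d -> R) (x0 : 'rV[R]_d) (T : nat)
    (disp : measure_display) (Omega : measurableType disp)
    (perms : nat -> Omega -> 'S_n) (A : set 'rV[R]_d) :
  (forall t, (t < T)%N -> random_element (perms t)) ->
  measurable [set w | A (iterate gamma f x0 (fun t => perms t w) T)].
Proof.
elim: T A => [|T IHT] A mp /=.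
  have [Ax|Ax] := pselect (A x0).
    by rewrite (_ : [set _ | _] = setT)//; apply/seteqP; split.
  by rewrite (_ : [set _ | _] = set0)//; apply/seteqP; split.
rewrite (_ : [set _ | _] = \bigcup_(s in [set: 'S_n]) (perms T @^-1` [set s] `&`
    [set w | (epoch gamma f s @^-1` A)
               (iterate gamma f x0 (fun t => perms t w) T)])).
  apply: fin_bigcup_measurable => [|s _]; first exact: finite_finset.
  apply: measurableI; first exact: mp.
  by apply: IHT => t tT; apply: mp; exact: ltnW.
apply/seteqP; split => [w Aw|w [s _ [<-]]//].
by exists (perms T w).
Qed.

(** * Recursion over the epochs *)

Definition tail_noise (R : realType) (d n : nat) (v : 'I_n -> 'rV[R]_d)
    (p : 'S_n) : R :=
  \sum_(k < n) dot (\sum_(i < n | (k <= i)%N) v (p i))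
                   (\sum_(i < n | (k <= i)%N) v (p i)).

Lemma tail_noise_ge0 (R : realType) (d n : nat) (v : 'I_n -> 'rV[R]_d)
    (p : 'S_n) : 0 <= tail_noise v p.
Proof. by apply: sumr_ge0 => k _; exact: dot_ge0. Qed.

(** The gain in [epoch_descent] sums over all components, so the order p disappears and n times the
    gap of the average remains. Quadratic growth at the end point of the epoch turns it into the
    extra a r_(t+1) on the left. *)
Lemma epoch_contract (R : realType) (d n : nat) (f : 'I_n -> 'rV[R]_d -> R)
    (L mu gamma : R) (x xs : 'rV[R]_d) (p : 'S_n) :
  (0 < n)%N -> 0 < L -> 0 < mu -> 0 < gamma ->
  2 * (gamma * L * n%:R) ^+ 2 <= 1 ->
  (forall i z, differentiable (f i) z) ->
  (forall i, convex_function setT (f i)) -> (forall i, smooth L (f i)) ->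
  strongly_convex mu (average f) -> minimizer (average f) xs ->
  (1 + gamma * mu * n%:R) *
    dot (epoch gamma f p x - xs) (epoch gamma f p x - xs) <=
  dot (x - xs) (x - xs) +
  2 * gamma ^+ 3 * L * tail_noise (fun i => grad (f i) xs) p.
Proof.
move=> n0 L0 mu0 gm0 small df cf sf sc mx.
pose step y i := y - gamma *: grad (f (p i)) y.
pose y k := foldl step x (take k (enum 'I_n)).
have ystep (i : 'I_n) : y i.+1 = y i - gamma *: grad (f (p i)) (y i).
  rewrite /y (take_nth i) ?size_enum_ord// -cats1 foldl_cat/=.
  by rewrite nth_ord_enum.
have := @epoch_descent _ _ _ (fun i => f (p i)) L gamma y xs L0 gm0 small
  (fun i => df (p i)) (fun i => cf (p i)) (fun i => sf (p i)) ystep.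
have -> : y 0%N = x by rewrite /y take0.
have -> : y n = epoch gamma f p x.
  by rewrite /y -[X in take X _]size_enum_ord take_size.
set x' := epoch _ _ _ _.
have -> : \sum_i (f (p i) x' - f (p i) xs) =
    n%:R * (average f x' - average f xs).
  transitivity (\sum_i (f i x' - f i xs)).
    by rewrite [RHS](reindex_perm p).
  rewrite sumrB /average -mulrBr.
  by rewrite mulrA divff ?mul1r// pnatr_eq0 -lt0n.
have h := strongly_convex_minimizer x' mu0 sc mx.
have g2 : 0 <= 2 * gamma * n%:R by rewrite !mulr_ge0// ltW.
move=> h'; apply: le_trans h'; have := ler_wpM2l g2 h.
rewrite /tail_noise; lra.
Qed.

(** The noise of epoch t is divided by 1 + a in its own epoch and in each later one, T - t times in
    all. *)
Lemma iterate_le (R : realType) (d n : nat) (gamma a c : R)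
    (f : 'I_n -> 'rV[R]_d -> R) (x0 xs : 'rV[R]_d) (p : nat -> 'S_n)
    (N : 'S_n -> R) (T : nat) :
  0 < 1 + a ->
  (forall q x, (1 + a) * dot (epoch gamma f q x - xs) (epoch gamma f q x - xs)
     <= dot (x - xs) (x - xs) + c * N q) ->
  dot (iterate gamma f x0 p T - xs) (iterate gamma f x0 p T - xs) <=
  (1 + a)^-1 ^+ T * dot (x0 - xs) (x0 - xs) +
  \sum_(t < T) (1 + a)^-1 ^+ (T - t) * (c * N (p t)).
Proof.
move=> a0 H; elim: T => [|T IHT]; first by rewrite big_ord0 expr0 mul1r addr0.
have /= := H (p T) (iterate gamma f x0 p T).
rewrite mulrC -ler_pdivlMr// => /le_trans; apply.
rewrite mulrC big_ord_recr/= subSnn expr1 addrA mulrDr lerD2r exprS -mulrA.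
rewrite (eq_bigr (fun t : 'I_T => (1 + a)^-1 *
    ((1 + a)^-1 ^+ (T - t) * (c * N (p t))))); last first.
  by move=> t _; rewrite subSn ?exprS ?mulrA// ltnW.
by rewrite -mulr_sumr -mulrDr ler_wpM2l// invr_ge0 ltW.
Qed.

(** The sums satisfy s_(T+1) = (s_T + 1) / (1 + a), a map that is increasing and fixes 1 / a. *)
Lemma geometric_sum_le (R : realFieldType) (a : R) (T : nat) : 0 < a ->
  \sum_(t < T) (1 + a)^-1 ^+ (T - t) <= a^-1.
Proof.
move=> a0; have a1 : 0 < 1 + a by rewrite addr_gt0.
elim: T => [|T IHT]; first by rewrite big_ord0 invr_ge0 ltW.
rewrite big_ord_recr/= subSnn expr1.
rewrite (eq_bigr (fun t : 'I_T => (1 + a)^-1 * (1 + a)^-1 ^+ (T - t)));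
  last first.
  by move=> t _; rewrite subSn ?exprS// ltnW.
rewrite -mulr_sumr -[X in _ + X]mulr1 -mulrDr mulrC ler_pdivrMr//.
apply: le_trans (lerD IHT (lexx 1)) _.
by rewrite mulrDr mulr1 mulVf ?gt_eqF// addrC.
Qed.

(** The gap of the average lies between mu / 2 and L / 2 times |y - x|^2, the linear term vanishing
    at the minimizer. This is what yields a <= 1 for [inv1D_le]. *)
Lemma strongly_convex_le_smooth (R : realType) (d n : nat)
    (f : 'I_n -> 'rV[R]_d -> R) (L mu : R) (x y : 'rV[R]_d) :
  (0 < n)%N -> 0 < L -> 0 < mu -> (forall i z, differentiable (f i) z) ->
  (forall i, smooth L (f i)) -> strongly_convex mu (average f) ->
  minimizer (average f) x -> y != x -> mu <= L.
Proof.
move=> n0 L0 mu0 df sf sc mx yx.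
have h1 := strongly_convex_minimizer y mu0 sc mx.
have e0 : 0 < dot (y - x) (y - x).
  by rewrite lt_def dot_ge0 dot_eq0 subr_eq0 yx.
have h2 : average f y - average f x <= L / 2 * dot (y - x) (y - x).
  rewrite /average -mulrBr ler_pdivrMl ?ltr0n// -sumrB.
  apply: (@le_trans _ _ (\sum_i (dot (grad (f i) x) (y - x) +
      L / 2 * dot (y - x) (y - x)))).
    by apply: ler_sum => i _; have := descent x y L0 (df i) (sf i); lra.
  rewrite big_split/= -dot_suml (minimizer_average_grad n0 L0 df sf mx) dot0l.
  by rewrite add0r sumr_const card_ord mulr_natl.
have := le_trans h1 h2; rewrite ler_pM2r// => h; move: h; lra.
Qed.

Lemma inv1D_le (R : realFieldType) (a : R) : 0 <= a <= 1 ->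
  (1 + a)^-1 <= 1 - a / 2.
Proof.
move=> /andP[a0 a1]; rewrite -[_^-1]mul1r ler_pdivrMr; nra.
Qed.

Theorem theorem2 (R : realType) (d n : nat) (hn : (0 < n)%N)
    (f : 'I_n -> 'rV[R]_d -> R) (L mu gamma : R) (x0 xs : 'rV[R]_d) (T : nat)
    (disp : measure_display) (Omega : measurableType disp)
    (P : probability Omega R) (perms : nat -> Omega -> 'S_n)
    (f_diff : forall (i : 'I_n) (x : 'rV[R]_d), differentiable (f i) x)
    (f_convex : forall i : 'I_n, convex_function setT (f i))
    (mu_gt0 : 0 < mu)
    (avg_strongly_convex : strongly_convex mu (average f))
    (avg_smooth : smooth L (average f))
    (f_smooth : forall i : 'I_n, smooth L (f i))
    (xs_min : minimizer (average f) xs)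
    (gamma_gt0 : 0 < gamma)
    (gamma_le : gamma <= 1 / (Num.sqrt 2 * L * n%:R))
    (hperms : random_reshuffling P T perms \/ shuffle_once P T perms) :
  ('E_P[fun w => (enorm (iterate gamma f x0 (fun t => perms t w) T - xs) ^+ 2)%R] <=
    ((1 - gamma * mu * n%:R / 2) ^+ T * enorm (x0 - xs) ^+ 2 +
     gamma ^+ 2 * (L / mu) * n%:R * sigma2 f xs)%:E)%E.
Proof.
have nR : 0 < n%:R :> R by rewrite ltr0n.
(* For L <= 0 the upper bound on gamma would be nonpositive (1 / 0 being 0 when L = 0), against
   gamma > 0. *)
have L0 : 0 < L.
  rewrite ltNge; apply/negP => L0; have := lt_le_trans gamma_gt0 gamma_le.
  rewrite ltNge div1r invr_le0 => /negP; apply.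
  by rewrite mulr_le0_ge0 ?mulr_ge0_le0 ?sqrtr_ge0// ltW.
have small : 2 * (gamma * L * n%:R) ^+ 2 <= 1.
  have h : Num.sqrt 2 * (gamma * L * n%:R) <= 1.
    move: gamma_le; rewrite ler_pdivlMr ?mulr_gt0 ?sqrtr_gt0//.
    by congr (_ <= _); ring.
  have h0 : 0 <= Num.sqrt 2 * (gamma * L * n%:R).
    by rewrite !mulr_ge0 ?sqrtr_ge0// ltW.
  have : (Num.sqrt 2 * (gamma * L * n%:R)) ^+ 2 <= 1 by rewrite expr_le1.
  by rewrite exprMn sqr_sqrtr.
have [mp up] : (forall t, (t < T)%N -> random_element (perms t)) /\
    (forall t, (t < T)%N -> uniformly_distributed P (perms t)).
  case: hperms => [[]//|[pi0 [mpi upi E]]].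
  by split=> t tT; rewrite E.
set a := gamma * mu * n%:R.
have a0 : 0 < a by rewrite !mulr_gt0.
have a1 : 0 < 1 + a by rewrite addr_gt0.
pose v i := grad (f i) xs.
have v0 : \sum_i v i = 0 := minimizer_average_grad hn L0 f_diff f_smooth xs_min.
pose c := 2 * gamma ^+ 3 * L.
have c0 : 0 < c by rewrite !mulr_gt0// exprn_gt0.
pose h t p := (1 + a)^-1 ^+ (T - t) * (c * tail_noise v p).
have h0 t p : 0 <= h t p.
  by rewrite !mulr_ge0 ?tail_noise_ge0 ?exprn_ge0 ?invr_ge0 ?ltW.
set b := (1 + a)^-1 ^+ T * dot (x0 - xs) (x0 - xs).
have b0 : 0 <= b by rewrite mulr_ge0 ?dot_ge0// exprn_ge0// invr_ge0 ltW.
have le1 :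
    ('E_P[fun w =>
        (enorm (iterate gamma f x0 (fun t => perms t w) T - xs) ^+ 2)%R] <=
     'E_P[(fun w => b + \sum_(t < T) h t (perms t w))%R])%E.
  apply: expectation_le => //.
  - move=> _ A _; rewrite setTI.
    exact: (measurable_iterate gamma f x0
      ((fun z => enorm (z - xs) ^+ 2) @^-1` A) mp).
  - apply: measurable_funD => //; apply: measurable_sum => t.
    exact: (measurable_fun_random_element (h t) (mp t (ltn_ord t))).
  - by move=> w; exact: sqr_ge0.
  - by move=> w; rewrite addr_ge0// sumr_ge0.
  - apply/aeW => w; rewrite enorm_sqr; apply: iterate_le => // q x.
    exact: epoch_contract.
apply: le_trans le1 _.
rewrite (expectation_sum_uniform mp up b0 h0) lee_fin; apply: lerD.
  (* The bound mu <= L requires two distinct points, so it may fail if d = 0. *)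
  rewrite /b -enorm_sqr; have [->|x0s] := eqVneq x0 xs.
    by rewrite subrr enorm_sqr dot0l !mulr0.
  have muL := strongly_convex_le_smooth hn L0 mu_gt0 f_diff f_smooth
    avg_strongly_convex xs_min x0s.
  have aL : a <= gamma * L * n%:R by rewrite ler_pM2r// ler_pM2l.
  (* Here 2 (gamma L n)^2 <= 1 gives a <= gamma L n <= 1, so 1 / (1 + a) is at most the rate 1 - a /
     2, which is nonnegative. *)
  rewrite ler_wpM2r ?sqr_ge0// lerXn2r ?nnegrE ?invr_ge0 ?(ltW a1)//.
    by rewrite subr_ge0; nra.
  by apply: inv1D_le; rewrite ltW//=; nra.
set Q := \sum_i dot (v i) (v i).
have sE : sigma2 f xs = n%:R^-1 * Q.
  by congr (_ * _); apply: eq_bigr => i _; rewrite enorm_sqr.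
have Q0 : 0 <= Q by apply: sumr_ge0 => i _; exact: dot_ge0.
have facN : 0 < (n`!%:R : R) by rewrite ltr0n fact_gt0.
apply: (@le_trans _ _ (\sum_(t < T) (1 + a)^-1 ^+ (T - t) *
    (c * (n%:R / 2 * Q)))).
  apply: ler_sum => t _; rewrite /h -mulr_sumr mulrCA ler_wpM2l//.
    by rewrite exprn_ge0// invr_ge0 ltW.
  rewrite -mulr_sumr mulrCA ler_wpM2l ?(ltW c0)// ler_pdivrMl.
    by rewrite card_Sn; exact: sum_perm_tail_le.
  by rewrite card_Sn.
rewrite -mulr_suml.
have K0 : 0 <= c * (n%:R / 2 * Q) by rewrite !mulr_ge0// ltW.
apply: le_trans (ler_wpM2r K0 (geometric_sum_le T a0)) _.
(* The constants match exactly: 2 gamma^3 L (n / 2) Q / (gamma mu n) = gamma^2 (L / mu) Q, and Q is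
   n times [sigma2 f xs]. *)
rewrite le_eqVlt; apply/orP; left; apply/eqP; rewrite sE /a /c; field.
by rewrite !gt_eqF.
Qed.
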